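(* Let $n\ge 1$ and let $P_n(x)$ be the sextet polynomial of the pyrene chain $P_n$. Then the zeros of $P_n(x)$ are all real, distinct (i.e. each is simple), and lie in the open interval $$\left(-(\sqrt{2}+1)^2,\,-(\sqrt{2}-1)^2\right).$$
   Context: A hexagonal system is a finite connected plane graph without cut vertices in which every interior face is bounded by a regular hexagon of side length $1$; its hexagons are its interior faces. Let $H$ be a hexagonal system with at least one perfect matching (Kekulé structure). A Clar cover of $H$ is a spanning subgraph of $H$ each connected component of which is either a hexagon or an edge. A resonant pattern of $H$ is the set of hexagons of a Clar cover of $H$. The Clar number $C(H)$ is the maximum number of hexagons in a resonant pattern. The sextet polynomial of $H$ is $\sigma(H,x)=\sum_{k=0}^{C(H)}s(H,k)x^k$, where $s(H,k)$ is the number of resonant patterns of $H$ with exactly $k$ hexagons and $s(H,0)=1$. The pyrene chain $P_n$ ($n\ge 1$) is the hexagonal system with $4n$ hexagons consisting of a straight horizontal row of $2n$ hexagons $h_1,\dots,h_{2n}$ of the hexagonal lattice (consecutive ones sharing a vertical edge) together with, for each $i=1,\dots,n$, the lattice hexagon above the row adjacent to both $h_{2i-1}$ and $h_{2i}$ and the lattice hexagon below the row adjacent to both $h_{2i-1}$ and $h_{2i}$. Its sextet polynomial is denoted $P_n(x)=\sigma(P_n,x)$, and $P_0(x)=1$ by convention. These polynomials are determined by $P_0(x)=1$, $P_1(x)=x^2+4x+1$ and the known recurrence $P_n(x)=(x^2+4x+1)P_{n-1}(x)-x^2P_{n-2}(x)$ for $n\ge 2$. *)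

(* Defs.v *)
From HB Require Import structures.
From mathcomp Require Import all_boot all_order all_algebra.
From mathcomp Require Import finmap reals complex.

Set Implicit Arguments.
Unset Strict Implicit.
Unset Printing Implicit Defensive.

Import GRing.Theory Num.Theory.

(** A finite plane graph enters through its vertex type [T], its set [E] of
    edges (an edge being the set of its two endpoints), and the set [Hs] of its
    hexagons, a hexagon being the set of its six edges.  All graphs below have
    all of [T] as vertex set, so a spanning subgraph is a subset of [E]. *)
Section SextetPolynomial.

Variables (T : finType) (E : {set {set T}}) (Hs : {set {set {set T}}}).

Implicit Types (F A : {set {set T}}) (S : {set {set {set T}}}).

(* Edge set of the connected component of [x] in the spanning subgraph [F]; it
   is empty exactly when [x] is isolated, and otherwise it determines the
   component. *)
Definition component F (x : T) : {set {set T}} :=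
  [set e in F |
    e \subset [set y | connect [rel u v | [set u; v] \in F] x y]].

Definition components F : {set {set {set T}}} :=
  [set component F x | x : T].

Definition clar_cover F : bool :=
  (F \subset E) &&
  [forall A in components F,
    (A \in Hs) || [exists e in E, A == [set e]]].

Definition resonant_pattern S : bool :=
  [exists F, clar_cover F && (S == components F :&: Hs)].

Definition clar_number : nat :=
  \max_(S | resonant_pattern S) #|S|.

Definition num_resonant (k : nat) : nat :=
  #|[set S | resonant_pattern S && (#|S| == k)]|.

Definition sextet_poly : {poly int} :=
  (\poly_(k < clar_number.+1) (num_resonant k)%:R)%R.

End SextetPolynomial.

(** The hexagonal lattice, with every lattice hexagon of side 1 having two
    vertical edges.  The lattice vertex [(X, Y)] is the point of the plane
    with coordinates ((sqrt 3 / 2) X, (3/2) Y - delta / 2), where delta is 1 if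
    X + Y is odd and 0 otherwise.  The lattice hexagon [(a, b)] is the one whose
    lower left vertex is [(2a + b, b)]: its right neighbour is [(a + 1, b)], its
    upper left and upper right ones are [(a - 1, b + 1)] and [(a, b + 1)], its
    lower left and lower right ones are [(a, b - 1)] and [(a + 1, b - 1)]. *)
Definition corners (c : int * int) : seq (int * int) :=
  let X : int := (c.1 *+ 2 + c.2)%R in
  let Y : int := c.2 in
  [:: (X, Y); (X + 1, Y); (X + 2, Y);
      (X + 2, Y + 1); (X + 1, Y + 1); (X, Y + 1)]%R.

(** The plane graph formed by the boundaries of the lattice hexagons in [B].
    Its hexagons are the members of [B]; when [B] is the set of interior faces
    of a hexagonal system, this is that hexagonal system, every edge of which
    lies on some interior face since there is no cut vertex. *)
Section HexagonalSystem.

Variable B : {fset int * int}.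

Definition hex_vertices : {fset int * int} :=
  [fset v | c in B, v in corners c]%fset.

(* [next] is the cyclic successor in the sequence of corners. *)
Definition hexagon (c : int * int) : {set {set hex_vertices}} :=
  [set e : {set hex_vertices} | [exists u, exists v,
    [&& val u \in corners c, val v == next (corners c) (val u)
      & e == [set u; v]]]].

Definition hexagons : {set {set {set hex_vertices}}} :=
  [set hexagon (val c) | c : B].

Definition hex_edges : {set {set hex_vertices}} :=
  \bigcup_(h in hexagons) h.

Definition sextet_polynomial : {poly int} := sextet_poly hex_edges hexagons.

End HexagonalSystem.

(** The row hexagon h_k is [(k, 0)]; the lattice hexagons adjacent to both
    h_(2i-1) and h_(2i) are [(2i - 1, 1)] (above) and [(2i, -1)] (below). *)
Definition pyrene_chain (n : nat) : {fset int * int} :=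
  [fset c in [seq (k%:Z, 0) | k <- iota 1 n.*2]
          ++ [seq (i.*2%:Z - 1, 1) | i <- iota 1 n]
          ++ [seq (i.*2%:Z, -1) | i <- iota 1 n]]%fset%R.

(* Main.v *)
Require Import Defs.
From HB Require Import structures.
From mathcomp Require Import all_boot all_order all_algebra.
From mathcomp Require Import finmap reals complex trigo.
From mathcomp Require Import zify ring lra.

(** Two hexagons of a resonant pattern are components of one spanning subgraph,
    so they share no vertex ([resonant_disjoint]).  In the pyrene chain this
    necessary condition is also sufficient.  A set of vertex-disjoint hexagons
    is resonant as soon as some perfect matching alternates on the boundary of
    each of them, because the Clar cover then consists of these hexagons and of
    the matching edges away from them ([alternating_resonant]).  In the chain
    the required matching takes the vertical edge in each of the n + 1 columns
    that bound the blocks of four hexagons.  The upper and the lower hexagon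
    of a block carry one of their two perfect matchings, which one depending
    only on whether the right row hexagon of the block is in the set
    ([pyrene_matching]).

    Resonant patterns are therefore the independent sets of the graph on the
    hexagons in which two hexagons sharing a vertex are joined, and the sextet
    polynomial is the independence polynomial of that graph.  Deleting the
    hexagons of the last block one at a time ([independence_poly_rec]) yields
    P_n = (x^2 + 4x + 1) P_(n-1) - x^2 P_(n-2) ([sextet_polynomial_pyrene]).

    This is the Chebyshev recurrence: if x^2 + 4x + 1 = 2 x cos t, then
    P_n(x) sin t = x^n sin ((n+1) t) ([pyrene_real_sin]).  For each angle
    t = k pi / (n+1), k = 1, ..., n, the equation x^2 + 4x + 1 = 2 x cos t has
    two negative solutions with product 1, on either side of -1.  They are
    zeros of P_n, and 2n zeros are obtained in all.  As x + 1/x + 4 = 2 cos t,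
    distinct angles have distinct solutions, so these are all the zeros of a
    polynomial of degree at most 2n, and each is simple ([pyrene_realE]).
    Finally cos t > -1 and x < 0 give (x + 3)^2 < 8, which is the interval of
    the theorem, since (sqrt 2 + 1)^2 = 3 + 2 sqrt 2 and
    (sqrt 2 - 1)^2 = 3 - 2 sqrt 2. *)

Set Implicit Arguments.
Unset Strict Implicit.
Unset Printing Implicit Defensive.

Import Order.TTheory GRing.Theory Num.Theory.
Local Open Scope ring_scope.

(** * Resonant patterns and alternating perfect matchings *)

Section Resonance.

Variables (T : finType) (E : {set {set T}}) (Hs : {set {set {set T}}}).
Implicit Types (F h : {set {set T}}) (S : {set {set {set T}}}).

(** The generating-function form, in which the Clar number no longer occurs. *)
Lemma sextet_poly_sum :
  sextet_poly E Hs = \sum_(S | resonant_pattern E Hs S) 'X^#|S|.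
Proof.
have -> : sextet_poly E Hs = \sum_(k < (clar_number E Hs).+1)
    \sum_(S | resonant_pattern E Hs S && (#|S| == k)) 'X^k.
  rewrite /sextet_poly poly_def; apply: eq_bigr => k _.
  by rewrite sumr_const /num_resonant cardsE scaler_nat.
rewrite (exchange_big_dep (resonant_pattern E Hs)) /=; last by move=> k S _ /andP[].
apply: eq_bigr => S resS.
have ltS : (#|S| < (clar_number E Hs).+1)%N by rewrite ltnS /clar_number leq_bigmax_cond.
rewrite (bigD1 (Ordinal ltS)) ?resS /= // big1 ?addr0 // => k /andP[/eqP kS].
by rewrite -val_eqE /= kS eqxx.
Qed.

(** The vertex set of a hexagon [h], given by its edges, is [cover h]. *)
Definition vertex_disjoint S :=
  {in S &, forall g h, ~~ [disjoint cover g & cover h] -> g = h}.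

Definition linked F := connect [rel u v | [set u; v] \in F].

Lemma linked_sym F : connect_sym [rel u v | [set u; v] \in F].
Proof. by apply: sym_connect_sym => u v /=; rewrite setUC. Qed.

Lemma cover_component F x y :
  y \in cover (component F x) -> component F y = component F x.
Proof.
case/bigcupP=> e; rewrite !inE => /andP[_ /subsetP sub] ye.
have := sub _ ye; rewrite inE => xy.
rewrite /component; suff -> : [set z | linked F y z] = [set z | linked F x z] by [].
apply/setP=> z; rewrite !inE; apply/esym; apply: same_connect xy _; exact: linked_sym.
Qed.

(** A component is determined by any vertex on one of its edges. *)
Lemma resonant_disjoint S :
  resonant_pattern E Hs S -> S \subset Hs /\ vertex_disjoint S.
Proof.
case/existsP=> F /andP[_ /eqP ->]; split; first exact: subsetIr.
move=> g h /setIP[/imsetP[x _ ->] _] /setIP[/imsetP[y _ ->] _].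
by case/pred0Pn=> z /andP[/= /cover_component <- /cover_component <-].
Qed.

(** The function [m] is a perfect matching, a vertex being sent to its partner.
    Since it maps the vertices of each member of [S] to themselves, it also
    matches the vertices outside [S] among themselves; the Clar cover consists
    of [S] and of these outer matching edges.  The bound on [cover h] prevents
    an outer matching edge from counting as a hexagon. *)
Lemma alternating_resonant S (m : T -> T) :
    S \subset Hs -> vertex_disjoint S ->
    {in Hs, forall h, h \subset E} ->
    {in Hs, forall h e, e \in h -> (#|e| == 2)%N} ->
    {in Hs, forall h, 2 < #|cover h|}%N ->
    {in Hs, forall h, {in cover h &, forall x y, linked h x y}} ->
    involutive m -> (forall x, m x != x) -> (forall x, [set x; m x] \in E) ->
    {in S, forall h x, x \in cover h -> m x \in cover h} ->
  resonant_pattern E Hs S.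
Proof.
move=> SHs disjS HsE Hs2 Hs_gt2 Hsl mK mneq mE malt.
have sH h : h \in S -> h \in Hs by move/(subsetP SHs).
pose W := cover (\bigcup_(h in S) h).
pose M := [set [set x; m x] | x in ~: W].
pose F := (\bigcup_(h in S) h) :|: M.
have WP x : reflect (exists2 h, h \in S & x \in cover h) (x \in W).
  apply: (iffP bigcupP) => [[e /bigcupP[h hS he] xe]|[h hS /bigcupP[e he xe]]].
    by exists h => //; apply/bigcupP; exists e.
  by exists e => //; apply/bigcupP; exists h.
have mW x : (m x \in W) = (x \in W).
  suff {x}: forall x, x \in W -> m x \in W.
    by move=> H; apply/idP/idP=> /H //; rewrite mK.
  by move=> x /WP[h hS xh]; apply/WP; exists h => //; apply: malt.
have same g h x : g \in S -> h \in S -> x \in cover g -> x \in cover h -> g = h.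
  by move=> gS hS xg xh; apply: disjS => //; apply/pred0Pn; exists x; rewrite /= xg.
(* Together, [FS] and [FM] say that F has no edge between the vertex sets of
   distinct members of S and outer matching edges: these sets are closed under
   linking, hence the components. *)
have FS h e x : h \in S -> e \in F -> x \in e -> x \in cover h -> e \in h.
  move=> hS /setUP[/bigcupP[g gS eg]|/imsetP[y yW ->]] xe xh.
    by have <- // : g = h; apply: same xh => //; apply/bigcupP; exists e.
  have xW : x \in W by apply/WP; exists h.
  by move: yW xe; rewrite !inE => yW /orP[] /eqP xE; move: xW; rewrite xE ?mW (negPf yW).
have FM e x : e \in F -> x \in e -> x \notin W -> e = [set x; m x].
  move=> /setUP[/bigcupP[g gS eg]|/imsetP[y yW ->]] xe xW.
    by case/negP: xW; apply/WP; exists g => //; apply/bigcupP; exists e.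
  by move: xe; rewrite !inE => /orP[] /eqP -> //; rewrite mK setUC.
have compS h x : h \in S -> x \in cover h -> component F x = h.
  move=> hS xh; apply/setP=> e.
  have linkedE y : linked F x y = (y \in cover h).
    apply/idP/idP=> [|yh].
      have clo : closed [rel u v | [set u; v] \in F] (mem (cover h)).
        apply: intro_closed; first exact: linked_sym.
        move=> u v /= uvF uh; have uvh := FS _ _ _ hS uvF (set21 _ _) uh.
        by apply/bigcupP; exists [set u; v]; rewrite ?set22.
      by move=> xy; rewrite -[_ \in _](closed_connect clo xy).
    have := Hsl h (sH _ hS) x y xh yh; apply: connect_sub => u v /= uvh.
    by apply: connect1 => /=; apply/setUP; left; apply/bigcupP; exists h.
  rewrite inE; apply/andP/idP => [[eF /subsetP sube]|eh].
    have [e0|[y ye]] := set_0Vmem e; last first.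
      by have := sube _ ye; rewrite inE [connect _ _ _]linkedE; apply: FS.
    case/setUP: eF => [/bigcupP[g gS eg]|/imsetP[y _ e2]].
      by have := Hs2 g (sH _ gS) _ eg; rewrite e0 cards0.
    by have := set21 y (m y); rewrite -e2 e0 inE.
  split; first by apply/setUP; left; apply/bigcupP; exists h.
  apply/subsetP=> y ye; rewrite inE [connect _ _ _]linkedE; apply/bigcupP; by exists e.
have compM x : x \notin W -> component F x = [set [set x; m x]].
  move=> xW; have xmF : [set x; m x] \in F.
    by apply/setUP; right; apply/imsetP; exists x; rewrite ?inE.
  have linkedE y : linked F x y = (y \in [set x; m x]).
    apply/idP/idP=> [|].
      have clo : closed [rel u v | [set u; v] \in F] (mem [set x; m x]).
        apply: intro_closed; first exact: linked_sym.
        move=> u v /= uvF uh.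
        have uW : u \notin W by move: uh; rewrite !inE => /orP[] /eqP ->; rewrite ?mW.
        have := FM _ _ uvF (set21 _ _) uW => uvE.
        have : v \in [set u; m u] by rewrite -uvE set22.
        by move: uh; rewrite !inE => /orP[] /eqP ->; rewrite ?mK // orbC.
      by move=> xy; rewrite -[_ \in _](closed_connect clo xy) set21.
    by rewrite !inE => /orP[] /eqP ->; [exact: connect0|apply: connect1].
  apply/setP=> e; rewrite inE [RHS]inE.
  apply/andP/eqP => [[eF /subsetP sube]|->]; last first.
    by split=> //; apply/subsetP=> y; rewrite inE [connect _ _ _]linkedE.
  have [e0|[y ye]] := set_0Vmem e; last first.
    have := sube _ ye; rewrite inE [connect _ _ _]linkedE => yx.
    have yW : y \notin W by move: yx; rewrite !inE => /orP[] /eqP ->; rewrite ?mW.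
    rewrite (FM _ _ eF ye yW); move: yx; rewrite !inE => /orP[] /eqP -> //.
    by rewrite mK setUC.
  case/setUP: eF => [/bigcupP[g gS eg]|/imsetP[y _ e2]].
    by have := Hs2 g (sH _ gS) _ eg; rewrite e0 cards0.
  by have := set21 y (m y); rewrite -e2 e0 inE.
apply/existsP; exists F; apply/andP; split.
  apply/andP; split.
    apply/subsetP=> e /setUP[/bigcupP[h hS]|/imsetP[x _ -> //]].
    exact: (subsetP (HsE _ (sH _ hS))).
  apply/forall_inP=> _ /imsetP[x _ ->].
  have [/WP[h hS xh]|xW] := boolP (x \in W); first by rewrite (compS h) ?sH.
  by rewrite compM //; apply/orP; right; apply/exists_inP; exists [set x; m x].
apply/eqP/setP=> h; rewrite inE; apply/idP/andP=> [hS|[/imsetP[x _ ->]]].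
  split; last exact: sH.
  have /card_gt0P[x xh] : (0 < #|cover h|)%N by apply: leq_trans (Hs_gt2 _ (sH _ hS)).
  by apply/imsetP; exists x; rewrite ?(compS h).
have [/WP[g gS xg]|xW] := boolP (x \in W); first by rewrite (compS g).
by rewrite compM // => /Hs_gt2; rewrite /cover big_set1 cards2; case: (_ != _).
Qed.

End Resonance.

(** * Hexagons of the lattice in coordinates *)

(** Every hexagon is a translate of the one at the origin, so that facts about
    [next] on [corners c] reduce to computations on six explicit points. *)
Definition corner_shift (c w : int * int) : int * int :=
  (c.1 *+ 2 + c.2 + w.1, c.2 + w.2).

Definition corners0 : seq (int * int) :=
  [:: (0, 0); (1, 0); (2, 0); (2, 1); (1, 1); (0, 1)].

Lemma corner_shift_inj c : injective (corner_shift c).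
Proof. by move=> [x y] [x' y'] [/addrI -> /addrI ->]. Qed.

Lemma cornersE c : corners c = map (corner_shift c) corners0.
Proof. by rewrite /corners /corner_shift /= !addr0. Qed.

Lemma next_corner c w :
  next (corners c) (corner_shift c w) = corner_shift c (next corners0 w).
Proof. by rewrite cornersE next_map //; apply: corner_shift_inj. Qed.

(** In these coordinates the corners of a hexagon fill a 3 by 2 box, which turns
    incidence questions into linear arithmetic. *)
Lemma mem_corners c v :
  (v \in corners c) =
    (0 <= v.1 - (c.1 *+ 2 + c.2) <= 2) && (0 <= v.2 - c.2 <= 1).
Proof. by case: c v => a b [x y]; rewrite !inE !xpair_eqE /=; lia. Qed.

Definition overlap (c d : int * int) := has (mem (corners c)) (corners d).

Lemma overlapE c d : overlap c d =
    (`|2 * (c.1 - d.1) + (c.2 - d.2)| <= 2) && (`|c.2 - d.2| <= 1).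
Proof.
case: c d => a b [a' b'].
by rewrite /overlap [in corners (a', b')]/corners /= !mem_corners /=; lia.
Qed.

(** Consecutive points of a horizontal zigzag are always joined by an edge; a
    point is joined to the one above it exactly when the sum of its coordinates
    is even, as for the lower left corner (0, 0) of the hexagon at the origin. *)
Definition adjacent (u v : int * int) :=
  (u.2 == v.2) && (`|u.1 - v.1| == 1)
  || [&& u.1 == v.1, `|u.2 - v.2| == 1 & (2 %| u.1 + Num.min u.2 v.2)%Z].

Lemma adjacent_shift c w w' :
  adjacent (corner_shift c w) (corner_shift c w') = adjacent w w'.
Proof. by rewrite /adjacent /corner_shift /=; lia. Qed.

Lemma adjacent_corners0 w w' :
  w \in corners0 -> w' \in corners0 -> adjacent w w' ->
  w' = next corners0 w \/ w = next corners0 w'.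
Proof.
move=> w0 w0'; have : all (fun w => all (fun w' => adjacent w w' ==>
   (w' == next corners0 w) || (w == next corners0 w')) corners0) corners0 by vm_compute.
by move=> /allP/(_ _ w0)/allP/(_ _ w0')/implyP H /H /orP[] /eqP; [left|right].
Qed.

Section HexSystem.
Variable B : {fset int * int}.
Local Notation V := (hex_vertices B).

Lemma hex_vertexP v : reflect (exists2 c, c \in B & v \in corners c) (v \in V).
Proof.
apply: (iffP idP) => [/imfset2P[c cB [w wc ->]]|[c cB vc]].
  by exists c.
by apply/imfset2P; exists c => //; exists v.
Qed.

Lemma lift_vertex c v : c \in B -> v \in corners c -> exists x : V, val x = v.
Proof.
by move=> cB vc; have vV : v \in V by [apply/hex_vertexP; exists c]; exists [` vV]%fset.
Qed.

Lemma hexagon_edge c (x y : V) :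
    val x \in corners c -> val y \in corners c -> adjacent (val x) (val y) ->
  [set x; y] \in hexagon B c.
Proof.
move=> xc yc xy.
suff [yx|yx] : val y = next (corners c) (val x) \/ val x = next (corners c) (val y).
- by rewrite inE; apply/existsP; exists x; apply/existsP; exists y; rewrite xc yx !eqxx.
- rewrite inE; apply/existsP; exists y; apply/existsP; exists x.
  by rewrite yc yx setUC !eqxx.
move: (val x) (val y) xc yc xy => {x y} u v.
rewrite [in u \in _]cornersE [in v \in _]cornersE => /mapP[w w0 ->] /mapP[w' w0' ->].
rewrite adjacent_shift !next_corner => /(adjacent_corners0 w0 w0') [->|->];
  by [left|right].
Qed.

Lemma cover_hexagon c (x : V) :
  c \in B -> (x \in cover (hexagon B c)) = (val x \in corners c).
Proof.
move=> cB; apply/bigcupP/idP => [[e]|xc].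
  rewrite inE => /existsP[u /existsP[v /and3P[uc /eqP vE /eqP ->]]].
  by case/set2P=> -> //; rewrite vE mem_next.
have [|y yE] := @lift_vertex c (next (corners c) (val x)) cB; first by rewrite mem_next.
exists [set x; y]; last exact: set21.
rewrite inE; apply/existsP; exists x; apply/existsP; exists y.
by rewrite xc yE !eqxx.
Qed.

Lemma corner_lift c w :
  c \in B -> w \in corners0 -> exists x : V, val x = corner_shift c w.
Proof. by move=> cB w0; apply: lift_vertex cB _; rewrite cornersE map_f. Qed.

Lemma hexagon_edge_card c e : e \in hexagon B c -> (#|e| == 2)%N.
Proof.
rewrite inE => /existsP[u /existsP[v /and3P[uc /eqP vE /eqP ->]]].
rewrite cards2 -val_eqE vE; move: uc; rewrite cornersE => /mapP[w w0 ->].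
rewrite -cornersE next_corner (inj_eq (@corner_shift_inj _)).
by move: w w0; apply/allP; vm_compute.
Qed.

Lemma hexagon_cover_gt2 c : c \in B -> (2 < #|cover (hexagon B c)|)%N.
Proof.
move=> cB.
have [//|x xE] := @corner_lift c (0, 0) cB.
have [//|y yE] := @corner_lift c (1, 0) cB.
have [//|z zE] := @corner_lift c (2, 0) cB.
apply/card_gt2P; exists x, y, z; split; split; rewrite ?cover_hexagon //
  -?val_eqE ?xE ?yE ?zE ?cornersE ?map_f // ?(inj_eq (@corner_shift_inj _)) //.
Qed.

Lemma hexagon_linked c : c \in B ->
  {in cover (hexagon B c) &, forall x y, linked (hexagon B c) x y}.
Proof.
move=> cB.
have [//|o oE] := @corner_lift c (0, 0) cB.
(* Walking around the hexagon from the corner [o] reaches all its corners. *)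
have root k x : (k < 6)%N -> val x = corner_shift c (nth (0, 0) corners0 k) ->
    linked (hexagon B c) o x.
  elim: k x => [|k IHk] x ltk xE.
    by have -> : x = o; [apply: val_inj; rewrite xE oE | apply: connect0].
  have k0 : nth (0, 0) corners0 k \in corners0 by rewrite mem_nth // ltnW.
  have [y yE] := corner_lift cB k0.
  apply: connect_trans (IHk _ (ltnW ltk) yE) _; apply: connect1 => /=.
  rewrite inE; apply/existsP; exists y; apply/existsP; exists x.
  rewrite eqxx andbT yE xE next_corner cornersE map_f //= (inj_eq (@corner_shift_inj _)).
  by case: k ltk {IHk xE k0 yE} => [|[|[|[|[|k]]]]].
have {}root x : x \in cover (hexagon B c) -> linked (hexagon B c) o x.
  rewrite cover_hexagon // cornersE => /mapP[w w0 xE].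
  have ltw : (index w corners0 < 6)%N by rewrite -[6%N]/(size corners0) index_mem.
  by apply: root ltw _; rewrite nth_index.
move=> x y /root ox /root; apply: connect_trans.
by rewrite /linked linked_sym.
Qed.

Lemma hexagon_inj : {in B &, injective (hexagon B)}.
Proof.
move=> c d cB dB cd.
have sub w : w \in corners0 -> corner_shift c w \in corners d.
  move=> w0; have [x xE] := corner_lift cB w0.
  by rewrite -xE -(cover_hexagon x dB) -cd (cover_hexagon x cB) xE cornersE map_f.
(* Two opposite corners already determine the box. *)
have := sub (0, 0) isT; have := sub (2, 1) isT.
by case: c d {cB dB cd sub} => a b [a' b']; rewrite !mem_corners /= => ? ?; apply/eqP;
   rewrite xpair_eqE; lia.
Qed.

End HexSystem.

(** * Independence polynomials and sextet polynomials *)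

Section Independence.
Variables (T : finType) (e : rel T).
Hypotheses (e_refl : reflexive e) (e_sym : symmetric e).

(** The graph is given by a reflexive relation, like that of sharing a vertex;
    hence the conclusion [x == y], and in [independence_poly_rec] the closed
    neighbourhood of [c] is where [e c] holds. *)
Definition independent (A : {set T}) :=
  [forall x in A, forall y in A, e x y ==> (x == y)].

Definition independence_poly (U : {set T}) : {poly int} :=
  \sum_(A : {set T} | (A \subset U) && independent A) 'X^#|A|.

Lemma independentP (A : {set T}) :
  reflect {in A &, forall x y, e x y -> x = y} (independent A).
Proof.
apply: (iffP forall_inP) => [H x y xA yA exy|H x xA].
  by have /forall_inP/(_ _ yA)/implyP/(_ exy)/eqP := H _ xA.
by apply/forall_inP=> y yA; apply/implyP=> exy; apply/eqP/H.
Qed.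

(** Independent sets either avoid [c], or consist of [c] and of an independent
    set avoiding the closed neighbourhood of [c]. *)
Lemma independence_poly_rec (U : {set T}) c : c \in U ->
  independence_poly U =
    independence_poly (U :\ c) + 'X * independence_poly [set y in U | ~~ e c y].
Proof.
move=> cU; rewrite /independence_poly (bigID (fun A : {set T} => c \in A)) /= addrC.
congr (_ + _).
  apply: eq_bigl => A; rewrite subsetD1.
  by case: (A \subset U); case: (independent A); case: (c \in A).
have cN (A : {set T}) : A \subset [set y in U | ~~ e c y] -> c \notin A.
  by move=> /subsetP sub; apply/negP=> /sub; rewrite inE e_refl andbF.
rewrite mulr_sumr (reindex_onto (fun A => c |: A) (fun A => A :\ c)) /=; last first.
  by move=> A /andP[_ cA]; rewrite setD1K.
apply: eq_big => [A|A /andP[_ /eqP AE]]; last first.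
  have cA : c \notin A by rewrite -AE setD11.
  by rewrite cardsU1 cA exprS.
rewrite setU11 andbT; apply/idP/idP.
- case/andP=> /andP[sub /independentP ind] /eqP AE.
  have cA : c \notin A by rewrite -AE setD11.
  apply/andP; split.
    apply/subsetP=> y yA; rewrite inE (subsetP sub) ?setU1r //=.
    by apply: contra cA => /ind -> //; rewrite ?setU11 ?setU1r.
  by apply/independentP=> x y xA yA; apply: ind; rewrite setU1r.
- case/andP=> sub /independentP ind.
  rewrite setU1K ?cN // eqxx andbT; apply/andP; split.
    apply/subsetP=> y /setU1P[-> //|/(subsetP sub)]; by rewrite inE => /andP[].
  have ce y : y \in A -> e c y = false.
    by move=> /(subsetP sub); rewrite inE => /andP[_ /negPf].
  apply/independentP=> x y /setU1P[->|xA] /setU1P[->|yA] //;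
    by [rewrite ce|rewrite e_sym ce|apply: ind].
Qed.

End Independence.

Section Sextet.
Variable B : {fset int * int}.
Local Notation V := (hex_vertices B).
Local Notation overlapB := (fun c d : B => overlap (val c) (val d)).
Local Notation hexB := (fun c : B => hexagon B (val c)).

Lemma overlap_refl : reflexive overlapB.
Proof. by move=> c; rewrite overlapE !subrr. Qed.

Lemma overlap_sym : symmetric overlapB.
Proof.
by move=> c d; rewrite /overlap; apply/hasP/hasP => -[v]; exists v.
Qed.

Lemma hexB_inj : injective hexB.
Proof. by move=> c d /hexagon_inj H; apply/val_inj/H; apply: valP. Qed.

Lemma cover_overlap (c d : B) :
  ~~ [disjoint cover (hexB c) & cover (hexB d)] = overlapB c d.
Proof.
rewrite disjoints_subset; apply/subsetPn/hasP => [[x xc]|[v vd vc]].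
  rewrite inE negbK => xd; exists (val x).
    by rewrite -(cover_hexagon x (valP d)).
  by move: xc; rewrite (cover_hexagon x (valP c)).
have [x xE] := lift_vertex (valP c) vc.
exists x; first by rewrite (cover_hexagon x (valP c)) xE.
by rewrite inE negbK (cover_hexagon x (valP d)) xE.
Qed.

Lemma vertex_disjoint_hexagons (A : {set B}) :
  independent overlapB A <-> vertex_disjoint (hexB @: A).
Proof.
split=> [/independentP ind _ _ /imsetP[c cA ->] /imsetP[d dA ->]|dis].
  by rewrite cover_overlap => /ind ->.
apply/independentP=> c d cA dA; rewrite -cover_overlap => /dis cd.
by apply/hexB_inj/cd; apply: imset_f.
Qed.

(** The criterion [alternating_resonant] for a polyhex, with the matching given
    on the points of the lattice rather than on the vertex type of the graph. *)
Lemma matched_resonant (A : {set B}) (m : int * int -> int * int) :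
    independent overlapB A ->
    {in V, forall v, exists c,
      [/\ c \in B, v \in corners c, m v \in corners c & adjacent v (m v)]} ->
    {in V, involutive m} ->
    {in A, forall c, {homo m : v / v \in corners (val c)}} ->
  resonant_pattern (hex_edges B) (hexagons B) (hexB @: A).
Proof.
move=> indA mE mK malt.
have mV (x : V) : exists y : V, val y == m (val x).
  have [c [cB _ mc _]] := mE _ (valP x).
  by have [y <-] := lift_vertex cB mc; exists y.
pose M x := xchoose (mV x).
have ME x : val (M x) = m (val x) by apply/eqP/(xchooseP (mV x)).
have HsP h : h \in hexagons B -> exists2 c, c \in B & h = hexagon B c.
  by case/imsetP=> c _ ->; exists (val c) => //; apply: valP.
apply: (@alternating_resonant _ _ _ _ M).
- by apply/subsetP=> _ /imsetP[c _ ->]; apply: imset_f.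
- exact/vertex_disjoint_hexagons.
- by move=> h hH; apply: bigcup_sup.
- by move=> _ /HsP[c _ ->] e; apply: hexagon_edge_card.
- by move=> _ /HsP[c cB ->]; apply: hexagon_cover_gt2.
- by move=> _ /HsP[c cB ->]; apply: hexagon_linked.
- by move=> x; apply: val_inj; rewrite !ME mK // (valP x).
- move=> x; rewrite -val_eqE ME; have [c [_ _ _]] := mE _ (valP x).
  by apply: contraTneq => ->; rewrite /adjacent !subrr !eqxx.
- move=> x; have [c [cB xc mc adj]] := mE _ (valP x).
  apply/bigcupP; exists (hexagon B c); last by apply: hexagon_edge; rewrite ?ME.
  by apply/imsetP; exists [` cB]%fset.
- move=> _ /imsetP[c cA ->] x.
  rewrite (cover_hexagon x (valP c)) (cover_hexagon (M x) (valP c)) ME.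
  exact: malt.
Qed.

(** The converse of the hypothesis is [resonant_disjoint], so that resonant
    patterns and independent sets of hexagons correspond to each other. *)
Lemma sextet_polynomial_independence :
    (forall A : {set B}, independent overlapB A ->
      resonant_pattern (hex_edges B) (hexagons B) (hexB @: A)) ->
  sextet_polynomial B = independence_poly overlapB setT.
Proof.
move=> res; rewrite /sextet_polynomial sextet_poly_sum /independence_poly.
have imK (A : {set B}) : hexB @^-1: (hexB @: A) = A.
  apply/setP=> c; rewrite inE mem_imset //; exact: hexB_inj.
rewrite (reindex_onto (fun A : {set B} => hexB @: A) (fun S => hexB @^-1: S)) /=.
  apply: eq_big => [A|A _]; last by rewrite card_imset //; apply: hexB_inj.
  rewrite imK eqxx andbT subsetT; apply/idP/idP => [|/res //].
  by case/resonant_disjoint=> _ /vertex_disjoint_hexagons.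
move=> S /resonant_disjoint[/subsetP sub _]; apply/setP=> h.
apply/imsetP/idP => [[c]|hS]; first by rewrite inE => + ->.
by have /imsetP[c _ hE] := sub _ hS; exists c; rewrite // inE -hE.
Qed.

End Sextet.

(** * The sextet polynomial of the pyrene chain *)

Lemma mem_pyrene_chain n c : (c \in pyrene_chain n) =
  (1 <= c.1 <= n.*2%:Z) &&
  [|| c.2 == 0, (c.2 == 1) && (c.1 %% 2 == 1)%Z | (c.2 == -1) && (c.1 %% 2 == 0)%Z].
Proof.
case: c => a b; rewrite !inE /=; apply/idP/idP.
  case/or3P=> /mapP[k]; rewrite mem_iota => k_n [-> ->] /=; lia.
case/andP=> a_n /or3P[/eqP ->|/andP[/eqP -> a2]|/andP[/eqP -> a2]]; apply/or3P.
- apply: Or31; apply/mapP; exists `|a|%N; [rewrite mem_iota|congr (_, _)]; lia.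
- apply: Or32; apply/mapP; exists (`|a|.+1)./2%N; [rewrite mem_iota|congr (_, _)]; lia.
- apply: Or33; apply/mapP; exists (`|a|./2)%N; [rewrite mem_iota|congr (_, _)]; lia.
Qed.

(** The i-th block of the chain has its upper and lower hexagon at columns
    4i - 1, 4i, 4i + 1, i.e. [p] = 0, 1, 2; the columns with [p] = 3 bound the
    blocks.  By default the central column of an upper or lower hexagon is
    matched to the left and the right column vertically; this alternates on the
    upper, the lower and the left row hexagon of the block.  When [r i] holds
    the mirror image is used, which alternates on the right row hexagon instead
    of the left one.  The flag [r i] stands for the presence of that hexagon
    (2i, 0) in the pattern. *)
Definition pyrene_matching (r : int -> bool) (v : int * int) : int * int :=
  let i := ((v.1 + 1) %/ 4)%Z in
  let p := ((v.1 + 1) %% 4)%Z in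
  let vertical := (v.1, if 1 <= v.2 then 3 - v.2 else - 1 - v.2) in
  if p == 3 then (v.1, 1 - v.2)
  else if p == (if r i then 0 else 2) then vertical
  else if p == (if r i then 1 else 0) then (v.1 + 1, v.2)
  else (v.1 - 1, v.2).

Section PyreneChain.
Variable n : nat.
Local Notation B := (pyrene_chain n).
Local Notation V := (hex_vertices B).
Local Notation overlapB := (fun c d : B => overlap (val c) (val d)).
Local Notation hexB := (fun c : B => hexagon B (val c)).

(** The columns congruent to 2 modulo 4, which bound the blocks, only meet the
    row; the other ones also meet the upper and the lower hexagons. *)
Lemma pyrene_vertex v : v \in V ->
  (0 <= v.2 <= 1) && (2 <= v.1 <= 4 * n%:Z + 2) ||
  [&& -1 <= v.2 <= 2, 3 <= v.1 <= 4 * n%:Z + 1 & (v.1 + 1) %% 4 != 3]%Z.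
Proof.
case/hex_vertexP => -[a b]; case: v => x y.
rewrite mem_pyrene_chain mem_corners /=; lia.
Qed.

Lemma pyrene_matching_edge r v : (0 < n)%N -> v \in V ->
  exists c, [/\ c \in B, v \in corners c, pyrene_matching r v \in corners c
     & adjacent v (pyrene_matching r v)].
Proof.
move=> n_gt0 /pyrene_vertex; case: v => x y /= vV.
(* A bounding column lies on the row hexagon to its left, except the first one,
   which lies on the row hexagon (1, 0). *)
pose i := ((x + 1) %/ 4)%Z; pose p := ((x + 1) %% 4)%Z.
exists (if p == 3 then if x == 2 then (1, 0) else (2 * i, 0)
        else if 1 <= y then (2 * i - 1, 1) else (2 * i, -1)).
rewrite /pyrene_matching /adjacent /= -/p -/i; move: (r i) => ri.
have [p3|p3] := eqVneq p 3; [case: ifP => x2|case: ifP => y1];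
  rewrite mem_pyrene_chain !mem_corners /=; split; subst p i.
all: case: ri => /=; do ?case: ifP => ? /=; lia.
Qed.

Lemma pyrene_matching_involutive r : {in V, involutive (pyrene_matching r)}.
Proof.
move=> v /pyrene_vertex; case: v => x y /= vV.
(* Matched vertices lie in the same block, hence consult the same flag. *)
have [x' [y' [vE iE]]] : exists x' y', pyrene_matching r (x, y) = (x', y') /\
    ((x' + 1) %/ 4 = (x + 1) %/ 4)%Z.
  rewrite /pyrene_matching /=; case: (r _);
  by do 3?[case: ifP => ? /=]; do 2 eexists; split=> //; lia.
rewrite vE; move: vE; rewrite /pyrene_matching /= iE; case: (r _);
do 3?[case: ifP => ? /=] => -[? ?]; do 3?[case: ifP => ? /=]; congr (_, _); lia.
Qed.

(** The left and the right row hexagon of a block share an edge, so if the former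
    is in [A] then the flag of the block is off, and the matching alternates
    on it; the upper and the lower hexagon suit both values of the flag. *)
Lemma pyrene_resonant (A : {set B}) : (0 < n)%N -> independent overlapB A ->
  resonant_pattern (hex_edges B) (hexagons B) (hexB @: A).
Proof.
move=> n_gt0 indA.
pose r i := [exists c in A, val c == (2 * i, 0)].
apply: (@matched_resonant _ _ (pyrene_matching r)) => //.
- by move=> v; apply: pyrene_matching_edge.
- exact: pyrene_matching_involutive.
move=> c cA v.
(* The row hexagon (a, 0) belongs to the block of index (a + 1) / 2. *)
have rP : (val c).2 = 0 -> r (((val c).1 + 1) %/ 2)%Z = ((val c).1 %% 2 == 0)%Z.
  move=> c0; have [c2|c2] := boolP (((val c).1 %% 2)%Z == 0).
    apply/exists_inP; exists c => //; case: (val c) c0 c2 => a b /= -> *.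
    by apply/eqP; congr (_, _); lia.
  apply/exists_inP => -[d dA /eqP dE].
  have : d = c.
    apply: (independentP _ _ indA) => //; rewrite overlapE dE /= c0; lia.
  by move=> dc; move: c2; rewrite -dc dE /=; lia.
have := valP c; rewrite mem_pyrene_chain !mem_corners.
case: (val c) v rP => a b [x y] /= rP abB xy.
have [b0|b0] := eqVneq b 0; last first.
  rewrite /pyrene_matching /=; case: (r _);
  do 3?[case: ifP => ? /=]; lia.
have {}rP := rP b0; rewrite {}b0 /pyrene_matching /= in abB xy *.
(* The bounding columns of a block do not consult its flag. *)
have [p3|p3] /= := eqVneq ((x + 1) %% 4)%Z 3; first by lia.
have -> : ((x + 1) %/ 4)%Z = ((a + 1) %/ 2)%Z by lia.
by rewrite {}rP; have [a2|a2] /= := eqVneq (a %% 2)%Z 0; do 3?[case: ifP => ? /=]; lia.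
Qed.

(** Parts of the chain are cut out by predicates on lattice positions, so that
    their equality is a matter of linear arithmetic. *)
Definition region_poly (p : pred (int * int)) :=
  independence_poly overlapB [set c : B | p (val c)].

Lemma eq_region_poly p q : {in B, p =1 q} -> region_poly p = region_poly q.
Proof.
move=> pq; rewrite /region_poly; congr (independence_poly _).
by apply/setP=> c; rewrite !inE pq // (valP c).
Qed.

Lemma region_poly_rec (p : pred (int * int)) c : c \in B -> p c ->
  region_poly p = region_poly (fun d => p d && (d != c))
    + 'X * region_poly (fun d => p d && ~~ overlap c d).
Proof.
move=> cB pc; rewrite /region_poly (@independence_poly_rec _ _ _ _ _ [` cB]%fset) ?inE //.
- congr (_ + _ * _); congr (independence_poly _); apply/setP=> d; rewrite !inE //.
  by rewrite andbC -val_eqE.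
- exact: overlap_refl.
- exact: overlap_sym.
Qed.

(** The hexagons of the i-th block are the ones with abscissa 2i - 1 or 2i.  A
    left row hexagon of the next block excludes the last row hexagon (2m, 0) of
    the first m blocks, whence the trimmed variant. *)
Definition first_blocks (m : nat) := region_poly (fun c => c.1 <= m.*2%:Z).
Definition first_blocks_trimmed (m : nat) :=
  region_poly (fun c => (c.1 <= m.*2%:Z) && (c != (m.*2%:Z, 0))).

Ltac region_eq :=
  rewrite /first_blocks /first_blocks_trimmed; apply: eq_region_poly => -[a b];
  rewrite mem_pyrene_chain ?overlapE ?xpair_eqE /=; lia.

Lemma first_blocks_rec m : (m < n)%N ->
  first_blocks m.+1 = ('X ^+ 2 + 3 *: 'X + 1) * first_blocks m + 'X * first_blocks_trimmed m.
Proof.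
move=> mn.
(* K : the first m blocks together with the lower hexagon of the next one. *)
pose K := region_poly (fun d => (d.1 <= m.*2%:Z) || (d == (m.+1.*2%:Z, -1))).
have KE : K = first_blocks m + 'X * first_blocks m.
  rewrite {1}/K (@region_poly_rec _ (m.+1.*2%:Z, -1)) ?mem_pyrene_chain ?eqxx ?orbT /=;
    try lia.
  by congr (_ + _ * _); region_eq.
(* The right row, the left row and the upper hexagon of the new block are
   removed in this order; the lower one is treated by [KE]. *)
rewrite {1}/first_blocks (@region_poly_rec _ (m.+1.*2%:Z, 0)) ?mem_pyrene_chain /=; try lia.
rewrite (@region_poly_rec _ (m.*2.+1%:Z, 0)) ?mem_pyrene_chain ?xpair_eqE /=; try lia.
rewrite (@region_poly_rec _ (m.*2.+1%:Z, 1)) ?mem_pyrene_chain ?xpair_eqE /=; try lia.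
transitivity (K + 'X * K + 'X * first_blocks_trimmed m + 'X * first_blocks m).
  by congr (_ + _ * _ + _ * _ + _ * _); region_eq.
by rewrite KE -mul_polyC; ring.
Qed.

(** The last row hexagon (2m + 2, 0) overlaps the rest of its block and nothing
    before it. *)
Lemma first_blocks_trimmedE m :
  (m < n)%N -> first_blocks_trimmed m.+1 = first_blocks m.+1 - 'X * first_blocks m.
Proof.
move=> mn; have -> : first_blocks m.+1 = first_blocks_trimmed m.+1 + 'X * first_blocks m;
  last by rewrite addrK.
rewrite {1}/first_blocks (@region_poly_rec _ (m.+1.*2%:Z, 0)) ?mem_pyrene_chain /=; try lia.
by congr (_ + _ * _); region_eq.
Qed.

Lemma first_blocks0 : first_blocks 0 = 1 /\ first_blocks_trimmed 0 = 1.
Proof.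
have sum0 p : {in B, p =1 pred0} -> region_poly p = 1.
  move=> /eq_region_poly ->; rewrite /region_poly /independence_poly.
  rewrite (big_pred1 set0) ?cards0 //.
  move=> U /=; rewrite (_ : [set _ | _] = set0); last by apply/setP=> c; rewrite !inE.
  rewrite subset0; case: eqP => //= ->; apply/independentP => x y; by rewrite inE.
by split; apply: sum0 => -[a b]; rewrite mem_pyrene_chain /=; lia.
Qed.

End PyreneChain.

(** The pair (P_n, P_(n-1)) with P_(-1) = 0, which makes the two-step recurrence
    structural and consistent with P_1 = x^2 + 4x + 1. *)
Fixpoint pyrene_polys (n : nat) : {poly int} * {poly int} :=
  if n is m.+1 then
    let: (p, q) := pyrene_polys m in (('X ^+ 2 + 4 *: 'X + 1) * p - 'X ^+ 2 * q, p)
  else (1, 0).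

Lemma sextet_polynomial_pyrene n : (0 < n)%N ->
  sextet_polynomial (pyrene_chain n) = (pyrene_polys n).1.
Proof.
move=> n0; rewrite sextet_polynomial_independence; last first.
  by move=> A; apply: (pyrene_resonant n0).
have [i0 i0'] := first_blocks0 n.
have step m : (m <= n)%N -> first_blocks n m = (pyrene_polys m).1 /\
     first_blocks_trimmed n m = (pyrene_polys m).1 - 'X * (pyrene_polys m).2.
  elim: m => [|m IHm] mn; first by rewrite i0 i0' /= mulr0 subr0.
  have [IH IH'] := IHm (ltnW mn); rewrite first_blocks_trimmedE //.
  rewrite first_blocks_rec // IH IH' /=.
  by case: (pyrene_polys m) => p q /=; split; rewrite -!mul_polyC; ring.
have [<- _] := step n (leqnn n).
congr (independence_poly _ _); apply/setP=> c; rewrite !inE.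
by have := valP c; rewrite mem_pyrene_chain /=; case: (val c) => a b /=; lia.
Qed.

(** * The zeros *)

Section PyreneRoots.
Variable R : realType.
Implicit Types (x t : R) (n : nat).

Definition pyrene_real n : {poly R} := map_poly intr (pyrene_polys n).1.

Lemma pyrene_realS n : pyrene_real n.+2 =
  ('X ^+ 2 + 4 *: 'X + 1) * pyrene_real n.+1 - 'X ^+ 2 * pyrene_real n.
Proof.
rewrite /pyrene_real /=; case: (pyrene_polys n) => p q /=.
rewrite !(rmorphB, rmorphD, rmorphM, rmorphXn, rmorph1) /= map_polyZ /=.
by rewrite !map_polyX.
Qed.

Lemma pyrene_real0 : pyrene_real 0 = 1.
Proof. by rewrite /pyrene_real rmorph1. Qed.

Lemma pyrene_real1 : pyrene_real 1 = 'X ^+ 2 + 4 *: 'X + 1.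
Proof.
rewrite /pyrene_real /= mulr1 mulr0 subr0 !(rmorphD, rmorphXn, rmorph1) /= map_polyZ /=.
by rewrite !map_polyX.
Qed.

(** The recurrence of sin ((n+1) t) is
    sin ((n+2) t) = 2 cos t sin ((n+1) t) - sin (n t). *)
Lemma pyrene_real_sin n x t : x ^+ 2 + 4 * x + 1 = 2 * cos t * x ->
  (pyrene_real n).[x] * sin t = x ^+ n * sin (n.+1%:R * t).
Proof.
move=> xt.
suff H k : (pyrene_real k).[x] * sin t = x ^+ k * sin (k.+1%:R * t) /\
   (pyrene_real k.+1).[x] * sin t = x ^+ k.+1 * sin (k.+2%:R * t).
  by have [] := H n.
elim: k => [|k [IH1 IH2]].
  rewrite pyrene_real0 pyrene_real1 !hornerE xt; split=> //.
  by rewrite [2 * t]mulr_natl mulr2n sinD; ring.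
split=> //; rewrite pyrene_realS !hornerE xt.
transitivity (2 * cos t * x * ((pyrene_real k.+1).[x] * sin t)
              - x ^+ 2 * ((pyrene_real k).[x] * sin t)); first by ring.
rewrite IH1 IH2 (exprS x k.+1) (exprS x k).
have -> : k.+3%:R * t = k.+2%:R * t + t by ring.
have -> : k.+1%:R * t = k.+2%:R * t - t by ring.
by rewrite !sinD sinN cosN; ring.
Qed.

Lemma size_pyrene_real n : (size (pyrene_real n) <= n.*2.+1)%N.
Proof.
have q3 : (size ('X ^+ 2 + 4 *: 'X + 1 : {poly R})%R <= 3)%N.
  apply: leq_trans (size_polyD _ _) _; rewrite geq_max size_poly1 andbT.
  apply: leq_trans (size_polyD _ _) _; rewrite geq_max size_polyXn /=.
  by apply: leq_trans (size_scale_leq _ _) _; rewrite size_polyX.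
elim/ltn_ind: n => -[|[|n]] IH; first by rewrite pyrene_real0 size_poly1.
  by rewrite pyrene_real1.
rewrite pyrene_realS; apply: leq_trans (size_polyD _ _) _; rewrite size_polyN geq_max.
apply/andP; split; apply: leq_trans (size_polyMleq _ _) _; rewrite -subn1 leq_subLR.
  by apply: leq_trans (leq_add q3 (IH n.+1 _)) _; lia.
by rewrite size_polyXn; apply: leq_trans (leq_add (leqnn 3) (IH n _)) _; lia.
Qed.

Lemma pyrene_real_horner0 n : (pyrene_real n).[0] = 1.
Proof.
elim/ltn_ind: n => -[|[|n]] IH.
- by rewrite pyrene_real0 hornerE.
- by rewrite pyrene_real1 !hornerE; ring.
- by rewrite pyrene_realS !hornerE IH //; ring.
Qed.

(** The angles k pi / (n+1), 1 <= k <= n, are indexed from 0. *)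
Definition angle n k : R := k.+1%:R * (pi / n.+1%:R).

(** The solutions of x^2 + 4x + 1 = 2 x cos t are -y + sqrt (y^2 - 1) and
    -y - sqrt (y^2 - 1), where y = 2 - cos t > 1. *)
Definition pyrene_root n (kb : nat * bool) : R :=
  let y := 2 - cos (angle n kb.1) in
  - y + (-1) ^+ kb.2 * Num.sqrt (y ^+ 2 - 1).

Lemma angle_itv n k : (k < n)%N -> 0 < angle n k < pi.
Proof.
move=> kn; rewrite /angle; have pi0 := @pi_gt0 R.
rewrite mulr_gt0 ?divr_gt0 //= mulrCA -ltr_pdivlMl // mulVf ?gt_eqF //.
by rewrite ltr_pdivrMr // mul1r ltr_nat.
Qed.

Lemma cos_angle n k : (k < n)%N -> -1 < cos (angle n k) < 1.
Proof.
move=> /angle_itv /andP[a0 api]; rewrite -cospi -[X in _ && (_ < X)]cos0.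
by rewrite !ltr_cos ?in_itv /= ?lexx ?pi_ge0 ?(ltW a0) ?(ltW api) ?a0 ?api.
Qed.

(** The two solutions have product 1, hence lie on either side of -1, which
    tells them apart. *)
Lemma pyrene_root_spec n k b : (k < n)%N ->
  let x := pyrene_root n (k, b) in
  [/\ x ^+ 2 + 4 * x + 1 = 2 * cos (angle n k) * x, x < 0 & b = (x < -1)].
Proof.
move=> /cos_angle; rewrite /pyrene_root /=; set c := cos _ => /andP[c1 c2].
set y := 2 - c; set s := Num.sqrt _.
have s2 : s ^+ 2 = y ^+ 2 - 1 by rewrite sqr_sqrtr // /y; nra.
have s0 : 0 < s by rewrite sqrtr_gt0 /y; nra.
have [sy1 sy2] : y - 1 < s /\ s < y by rewrite /y in s2 *; split; nra.
case: b; rewrite ?expr1 ?expr0 ?mul1r ?mulN1r; split; try (by rewrite /y in s2 *; nra).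
Qed.

Lemma pyrene_root_root n k b : (k < n)%N -> root (pyrene_real n) (pyrene_root n (k, b)).
Proof.
move=> kn; have [xE _ _] := pyrene_root_spec b kn.
have sin_gt0 : 0 < sin (angle n k) by apply/sin_gt0_pi/angle_itv.
have := pyrene_real_sin n xE.
have -> : n.+1%:R * angle n k = pi *+ k.+1.
  by rewrite /angle mulrCA [n.+1%:R * _]mulrC divfK ?pnatr_eq0 // mulr_natl.
have sin_pin j : sin (pi *+ j) = 0 :> R.
  by elim: j => [|j IHj]; rewrite ?sin0 // mulrS addrC sinDpi IHj oppr0.
rewrite sin_pin mulr0 => /eqP; rewrite mulf_eq0 => /orP[//|]; by rewrite gt_eqF.
Qed.

(** A zero x determines cos t through x + 1/x + 4 = 2 cos t, hence the angle. *)
Lemma pyrene_root_inj n :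
  {in [pred kb : nat * bool | (kb.1 < n)%N] &, injective (pyrene_root n)}.
Proof.
move=> [k b] [k' b'] /= kn kn' eqx.
have [xE x0 bE] := pyrene_root_spec b kn.
have [xE' _ bE'] := pyrene_root_spec b' kn'.
rewrite -eqx in xE' bE'; congr (_, _); last by rewrite bE.
have : cos (angle n k) = cos (angle n k').
  apply: (mulIf (ltr0_neq0 x0)); apply: (@mulfI _ 2); first by rewrite pnatr_eq0.
  by rewrite !mulrA -xE -xE'.
move=> /cos_inj; have [/andP[a0 a1] /andP[a0' a1']] := (angle_itv kn, angle_itv kn').
rewrite !in_itv /= !ltW // => /(_ isT isT) /mulIf.
rewrite gt_eqF ?divr_gt0 ?pi_gt0 // => /(_ isT) /eqP.
by rewrite eqr_nat => /eqP[].
Qed.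

Lemma pyrene_root_itv n k b : (k < n)%N ->
  - (Num.sqrt 2 + 1) ^+ 2 < pyrene_root n (k, b) < - (Num.sqrt 2 - 1) ^+ 2.
Proof.
move=> kn; have [xE x0 _] := pyrene_root_spec b kn; have /andP[c1 _] := cos_angle kn.
move: (pyrene_root _ _) (cos _) xE x0 c1 => x c xE x0 c1.
set s := Num.sqrt 2; have s2 : s ^+ 2 = 2 by rewrite sqr_sqrtr.
have s0 : 0 < s by rewrite sqrtr_gt0.
(* x^2 + 6x + 1 = 2 (cos t + 1) x < 0 *)
have x3 : (x + 3) ^+ 2 < 8 by nra.
by apply/andP; split; nra.
Qed.

Definition pyrene_roots n : seq R :=
  [seq pyrene_root n kb | kb <- [seq (k, b) | k <- iota 0 n, b <- [:: true; false]]].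

Lemma pyrene_roots_uniq n : uniq (pyrene_roots n).
Proof.
rewrite map_inj_in_uniq; first by rewrite allpairs_uniq ?iota_uniq // => -[? ?] [? ?].
move=> _ _ /allpairsP[[k b] [kn _ ->]] /allpairsP[[k' b'] [kn' _ ->]].
by move: kn kn'; rewrite !mem_iota; apply: pyrene_root_inj.
Qed.

(** The polynomial has degree at most 2n and the 2n distinct zeros listed above;
    it is not zero, its constant coefficient being 1. *)
Lemma pyrene_realE n :
  pyrene_real n = lead_coef (pyrene_real n) *: \prod_(x <- pyrene_roots n) ('X - x%:P).
Proof.
have roots : all (root (pyrene_real n)) (pyrene_roots n).
  apply/allP=> _ /mapP[_ /allpairsP[[k b] /= [kn _ ->]] ->].
  by apply: pyrene_root_root; move: kn; rewrite mem_iota.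
have p0 : pyrene_real n != 0.
  apply/eqP=> p0; have := pyrene_real_horner0 n.
  by rewrite p0 horner0 => /eqP; rewrite eq_sym oner_eq0.
apply: all_roots_prod_XsubC => //; last by rewrite uniq_rootsE pyrene_roots_uniq.
apply/eqP; rewrite eqn_leq max_poly_roots ?pyrene_roots_uniq // andbT.
by rewrite size_map size_allpairs size_iota muln2 size_pyrene_real.
Qed.

End PyreneRoots.

Theorem theorem2p4 (R : realType) (n : nat) (hn : (1 <= n)%N) :
  let P : {poly R[i]} := map_poly intr (sextet_polynomial (pyrene_chain n)) in
  forall z : R[i], root P z ->
    (exists x : R, [/\ z = (x%:C)%C,
       - (Num.sqrt 2 + 1) ^+ 2 < x & x < - (Num.sqrt 2 - 1) ^+ 2])
    /\ mup z P = 1%N.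
Proof.
set P := map_poly _ _ => /= z.
pose a := (lead_coef (pyrene_real R n))%:C%C.
have PE : P = a *: \prod_(w <- [seq x%:C%C | x <- pyrene_roots R n]) ('X - w%:P).
  have -> : P = map_poly (real_complex R) (pyrene_real R n).
    rewrite /P sextet_polynomial_pyrene // /pyrene_real -map_poly_comp.
    by apply: eq_map_poly => k /=; rewrite rmorph_int.
  by rewrite pyrene_realE map_polyZ /= rmorph_prod /= big_map; congr (_ *: _);
     apply: eq_bigr => x _; rewrite rmorphB /= map_polyX map_polyC.
have a0 : a != 0.
  apply/eqP => a0; have := pyrene_real_horner0 R n.
  have {}a0 : lead_coef (pyrene_real R n) = 0 by apply: complexI.
  by rewrite pyrene_realE a0 scale0r horner0 => /eqP; rewrite eq_sym oner_eq0.
rewrite PE rootZ // root_prod_XsubC => zw; split.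
  have /mapP[_ /mapP[_ /allpairsP[[k b] /= [kn _ ->]] ->] ->] := zw.
  have kn' : (k < n)%N by move: kn; rewrite mem_iota.
  have /andP[lo hi] := pyrene_root_itv R b kn'.
  by exists (pyrene_root R n (k, b)).
rewrite -mul_polyC mupMr ?rootC // mu_prod_XsubC count_uniq_mem ?zw //.
by rewrite map_inj_uniq ?pyrene_roots_uniq //; apply: complexI.
Qed.
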